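(* Let $(\mathfrak m,\mathfrak g,\phi,\varphi,\sigma)$ be a crossed module of Lie $2$-algebras. Then its derivations $(\mathrm{Der}(\mathfrak g,\mathfrak m),\{\cdot,\cdot\})$, with underlying complex $\mathrm{Der}_1(\mathfrak g,\mathfrak m)=\mathrm{Hom}(\mathfrak g_0,\mathfrak m_1)\xrightarrow{-\mathrm D}\mathrm{Der}_0(\mathfrak g,\mathfrak m)$, form a strict Lie $2$-algebra.
   Context: All vector spaces are over a fixed ground field; $\wedge$ denotes skew-symmetry; $c.p.$ denotes the sum over the remaining cyclic permutations. Lie 2-algebras. A Lie 2-algebra $(\mathfrak g,d,l_2,l_3)$ is a 2-term complex $d:\mathfrak g_1\to\mathfrak g_0$ with a skew-symmetric bilinear bracket $l_2=[\cdot,\cdot]$ with components $\mathfrak g_0\times\mathfrak g_0\to\mathfrak g_0$ and $\mathfrak g_0\times\mathfrak g_1\to\mathfrak g_1$ ($[a,x]=-[x,a]$ and $[a,b]=0$ for $a,b\in\mathfrak g_1$), and a skew-symmetric trilinear $l_3:\wedge^3\mathfrak g_0\to\mathfrak g_1$, such that $d[x,a]=[x,da]$, $[da,b]=[a,db]$, $[[x,y],z]+c.p.=-dl_3(x,y,z)$, $[[x,y],a]+[[y,a],x]+[[a,x],y]=-l_3(x,y,da)$, and $\sum_{i=1}^4(-1)^{i+1}[x_i,l_3(x_1,..,\widehat{x_i},..,x_4)]+\sum_{i<j}(-1)^{i+j}l_3([x_i,x_j],x_1,..,\widehat{x_i},..,\widehat{x_j},..,x_4)=0$. It is strict if $l_3=0$.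 A Lie 2-algebra homomorphism $\psi=(\psi_0,\psi_1,\psi_2):\mathfrak g\to\mathfrak g'$ consists of linear maps $\psi_i:\mathfrak g_i\to\mathfrak g_i'$ ($i=0,1$) and $\psi_2:\wedge^2\mathfrak g_0\to\mathfrak g_1'$ with $d'\psi_1=\psi_0d$; $\psi_0[x,y]-[\psi_0x,\psi_0y]'=d'\psi_2(x,y)$; $\psi_1[x,a]-[\psi_0x,\psi_1a]'=\psi_2(x,da)$; $([\psi_0x,\psi_2(y,z)]'+c.p.)+l_3'(\psi_0x,\psi_0y,\psi_0z)=(\psi_2([x,y],z)+c.p.)+\psi_1l_3(x,y,z)$. Endomorphisms and derivations. For a 2-term complex $\mathbb V:V_1\xrightarrow{\partial}V_0$, $\mathrm{End}(\mathbb V)$ is the strict Lie 2-algebra with degree 0 part $\{(X_0,X_1):X_0\partial=\partial X_1\}$, degree 1 part $\mathrm{Hom}(V_0,V_1)$, differential $\delta(\Theta)=\partial\Theta+\Theta\partial$ and commutator brackets ($[X,\Theta]=X_1\Theta-\Theta X_0$). For a Lie 2-algebra $(\mathfrak m,\tilde d,\tilde l_2,\tilde l_3)$, $\mathrm{Der}(\mathfrak m)$ is the strict Lie 2-algebra with $\mathrm{Der}_1(\mathfrak m)=\mathrm{Hom}(\mathfrak m_0,\mathfrak m_1)$ and $\mathrm{Der}_0(\mathfrak m)$ the set of $X+l_X$, with $X=(X_0,X_1)$, $X_i\in\mathrm{End}(\mathfrak m_i)$, $l_X:\wedge^2\mathfrak m_0\to\mathfrak m_1$, satisfying $\tilde dX_1=X_0\tilde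 d$; $\tilde dl_X(\alpha,\beta)=X[\alpha,\beta]-[X\alpha,\beta]-[\alpha,X\beta]$; $l_X(\alpha,\tilde d\xi)=X[\alpha,\xi]-[X\alpha,\xi]-[\alpha,X\xi]$; $X\tilde l_3(\alpha,\beta,\gamma)=l_X(\alpha,[\beta,\gamma])+[\alpha,l_X(\beta,\gamma)]+\tilde l_3(X\alpha,\beta,\gamma)+c.p.(\alpha,\beta,\gamma)$. Its differential is $\Theta\mapsto\delta(\Theta)+l_{\delta(\Theta)}$ with $\delta(\Theta)=\tilde d\Theta+\Theta\tilde d$, $l_{\delta(\Theta)}(\alpha,\beta)=\Theta[\alpha,\beta]-[\alpha,\Theta\beta]-[\Theta\alpha,\beta]$; its brackets are $\{X+l_X,\Theta\}=[X,\Theta]$, $\{X+l_X,Y+l_Y\}=[X,Y]+X\triangleright l_Y-Y\triangleright l_X$, where $(X\triangleright l_Y)(\alpha,\beta)=Xl_Y(\alpha,\beta)-l_Y(X\alpha,\beta)-l_Y(\alpha,X\beta)$. Actions by derivations and crossed products. $\mathfrak g$ acts on $\mathfrak m$ by derivations if there are a Lie 2-algebra homomorphism $\phi=(\phi_0,\phi_1,\phi_2):\mathfrak g\to\mathrm{End}(\mathfrak m)$ and maps $l_{\phi_0(x)}:\wedge^2\mathfrak m_0\to\mathfrak m_1$ such that $\phi_0(x)+l_{\phi_0(x)}\in\mathrm{Der}_0(\mathfrak m)$ and $(\phi_0+l_{\phi_0},\phi_1,\phi_2):\mathfrak g\to\mathrm{Der}(\mathfrak m)$ is a Lie 2-algebra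 homomorphism. Write $x\triangleright\cdot=\phi_0(x)$, $a\triangleright\alpha=\phi_1(a)\alpha$, $(x,y)\triangleright\alpha=\phi_2(x,y)\alpha$ ($x,y\in\mathfrak g_0,a\in\mathfrak g_1,\alpha\in\mathfrak m_0$). The crossed product $\mathfrak g\triangleright_\phi\mathfrak m$ is the Lie 2-algebra on $\mathfrak g\oplus\mathfrak m$ with differential $d+\tilde d$, bracket $[x+\alpha,y+\beta]=l_2(x,y)+\tilde l_2(\alpha,\beta)+x\triangleright\beta-y\triangleright\alpha$ and $L_3(x+\alpha,y+\beta,z+\gamma)=l_3(x,y,z)+\tilde l_3(\alpha,\beta,\gamma)-(x,y)\triangleright\gamma-(y,z)\triangleright\alpha-(z,x)\triangleright\beta+l_{\phi_0(x)}(\beta,\gamma)+l_{\phi_0(y)}(\gamma,\alpha)+l_{\phi_0(z)}(\alpha,\beta)$. Crossed modules. A crossed module of Lie 2-algebras consists of Lie 2-algebras $\mathfrak m=(\mathfrak m,\tilde d,\tilde l_2,\tilde l_3)$ and $\mathfrak g=(\mathfrak g,d,l_2,l_3)$, an action $\phi$ of $\mathfrak g$ on $\mathfrak m$ by derivations, and a Lie 2-algebra homomorphism $\Pi:\mathfrak g\triangleright_\phi\mathfrak m\to\mathfrak g$ with $\Pi|_{\mathfrak g}=(\mathrm{id},\mathrm{id},0)$, such that (i) $\tilde l_2(\alpha,\beta)=\Pi(\alpha)\triangleright\beta$ for $\alpha,\beta\in\mathfrak m$ (all degrees); (ii) $\tilde l_3(\alpha,\beta,\gamma)=-(\Pi_0\alpha,\Pi_0\beta)\triangleright\gamma-\Pi_2(\Pi_0\alpha,\beta)\triangleright\gamma$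 for $\alpha,\beta,\gamma\in\mathfrak m_0$; (iii) $l_{\phi_0(x)}(\beta,\gamma)=-(x,\Pi_0\beta)\triangleright\gamma-\Pi_2(x,\beta)\triangleright\gamma$ for $x\in\mathfrak g_0$, $\beta,\gamma\in\mathfrak m_0$; (iv) $\Pi_2(\alpha,\beta)=\Pi_2(\Pi_0\alpha,\beta)=\Pi_2(\alpha,\Pi_0\beta)$ for $\alpha,\beta\in\mathfrak m_0$. It is denoted $(\mathfrak m,\mathfrak g,\phi,\varphi,\sigma)$ with $\varphi=(\varphi_0,\varphi_1,\varphi_2)=\Pi|_{\mathfrak m}$ and $\sigma=\Pi_2|_{\mathfrak g_0\wedge\mathfrak m_0}$ (so $\sigma(\alpha,x)=-\sigma(x,\alpha)$). Derivations of a crossed module. $\mathrm{Der}_0(\mathfrak g,\mathfrak m)$ is the set of 1-cocycles of $\mathfrak g$ with values in the $\mathfrak g$-module $\mathfrak m$: elements $X+l_X$ with $X=(X_0,X_1)\in\mathrm{Hom}(\mathfrak g_0,\mathfrak m_0)\oplus\mathrm{Hom}(\mathfrak g_1,\mathfrak m_1)$, $l_X\in\mathrm{Hom}(\wedge^2\mathfrak g_0,\mathfrak m_1)$ satisfying, for $x,y,z\in\mathfrak g_0,a\in\mathfrak g_1$: $X_0d=\tilde dX_1$; $\tilde dl_X(x,y)=X[x,y]+y\triangleright Xx-x\triangleright Xy$; $l_X(x,da)=X[x,a]+a\triangleright Xx-x\triangleright Xa$; $Xl_3(x,y,z)=l_X(x,[y,z])+x\triangleright l_X(y,z)-(y,z)\triangleright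 Xx+c.p.(x,y,z)$. For $\Theta\in\mathrm{Der}_1(\mathfrak g,\mathfrak m)=\mathrm{Hom}(\mathfrak g_0,\mathfrak m_1)$, $-\mathrm D(\Theta)=\delta(\Theta)+l_{\delta(\Theta)}$, where $\delta(\Theta)=(\tilde d\Theta,\Theta d)$ and $l_{\delta(\Theta)}(x,y)=\Theta[x,y]-x\triangleright\Theta y+y\triangleright\Theta x$. The brackets are $$\{X+l_X,Y+l_Y\}=[X,Y]_\varphi+X\triangleright l_Y-Y\triangleright l_X+\omega^\sigma(X,Y),\quad \{X+l_X,\Theta\}=[X,\Theta]_\varphi,\quad\{\Theta,\Theta'\}=0,$$ where $[X,Y]_\varphi=X\circ\varphi\circ Y-Y\circ\varphi\circ X$ (componentwise), $[X,\Theta]_\varphi=X_1\varphi_1\Theta-\Theta\varphi_0X_0$, $(X\triangleright l_Y)(x,y)=X_1\varphi_1l_Y(x,y)-l_Y(\varphi_0X_0x,y)-l_Y(x,\varphi_0X_0y)$ and $\omega^\sigma(X,Y)(x,y)=X_1\sigma(Y_0x,y)+X_1\sigma(x,Y_0y)-Y_1\sigma(X_0x,y)-Y_1\sigma(x,X_0y)$. *)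

(* Defs.v *)
From HB Require Import structures.
From mathcomp Require Import all_boot all_algebra.
From mathcomp Require Import all_classical.

(* Mathematical Components, with the classical logic of MathComp-Analysis:    *)
(* the latter makes the function space T -> V an lmodType (pointwise          *)
(* operations) whenever V is one, V being of arbitrary dimension.             *)

Set Implicit Arguments.
Unset Strict Implicit.
Unset Printing Implicit Defensive.

Import GRing.Theory.
Local Open Scope ring_scope.

Section Multilinear.
Variables (K : fieldType) (U V W Z : lmodType K).

Definition bilinear_map (f : U -> V -> W) : Prop :=
  (forall x, linear (f x)) /\ (forall y, linear (fun x => f x y)).

Definition trilinear_map (f : U -> V -> W -> Z) : Prop :=
  [/\ forall x y, linear (f x y), forall x z, linear (fun y => f x y z)
    & forall y z, linear (fun x => f x y z)].

Definition skew2 (f : U -> U -> W) : Prop := forall x y, f x y = - f y x.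

(* The two conditions are on transpositions that generate 'S_3. *)
Definition skew3 (f : U -> U -> U -> W) : Prop :=
  (forall x y z, f x y z = - f y x z) /\ (forall x y z, f x y z = - f x z y).

End Multilinear.

Definition cyc (T : Type) (W : zmodType) (f : T -> T -> T -> W) (x y z : T) : W :=
  f x y z + f y z x + f z x y.

Section Lie2Algebra.
Variables (K : fieldType).

(* V0 and V1 are the components of degree 0 and 1. The bracket is given by    *)
(* its components [x, y] = br0 x y and [x, a] = br1 x a.                      *)
Record lie2_ops (V0 V1 : lmodType K) := Lie2Ops {
  diff : V1 -> V0;
  br0 : V0 -> V0 -> V0;
  br1 : V0 -> V1 -> V1;
  jac : V0 -> V0 -> V0 -> V1
}.

(* The component [a, x] = - [x, a] of the bracket. *)
Definition br1' (V0 V1 : lmodType K) (g : lie2_ops V0 V1) (a : V1) (x : V0) : V1 :=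
  - br1 g x a.

Record is_lie2 (V0 V1 : lmodType K) (g : lie2_ops V0 V1) : Prop := IsLie2 {
  lie2_diff_linear : linear (diff g);
  lie2_br0_bilinear : bilinear_map (br0 g);
  lie2_br0_skew : skew2 (br0 g);
  lie2_br1_bilinear : bilinear_map (br1 g);
  lie2_jac_trilinear : trilinear_map (jac g);
  lie2_jac_skew : skew3 (jac g);
  lie2_diff_br : forall x a, diff g (br1 g x a) = br0 g x (diff g a);
  lie2_peiffer : forall a b, br1 g (diff g a) b = br1' g a (diff g b);
  lie2_jacobi0 : forall x y z,
    cyc (fun x y z => br0 g (br0 g x y) z) x y z = - diff g (jac g x y z);
  lie2_jacobi1 : forall x y a,
    br1 g (br0 g x y) a + br1' g (br1 g y a) x + br1' g (br1' g a x) y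
    = - jac g x y (diff g a);
  lie2_coherence : forall x1 x2 x3 x4,
    (br1 g x1 (jac g x2 x3 x4) - br1 g x2 (jac g x1 x3 x4)
     + br1 g x3 (jac g x1 x2 x4) - br1 g x4 (jac g x1 x2 x3))
    + (- jac g (br0 g x1 x2) x3 x4 + jac g (br0 g x1 x3) x2 x4
       - jac g (br0 g x1 x4) x2 x3 - jac g (br0 g x2 x3) x1 x4
       + jac g (br0 g x2 x4) x1 x3 - jac g (br0 g x3 x4) x1 x2) = 0
}.

Record lie2 (V0 V1 : lmodType K) := Lie2 {
  lie2_ops_of :> lie2_ops V0 V1;
  lie2P : is_lie2 lie2_ops_of
}.

Definition strict (V0 V1 : lmodType K) (g : lie2_ops V0 V1) : Prop :=
  forall x y z, jac g x y z = 0.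

(* Only the operations of g and h occur in these conditions, so that they     *)
(* also make sense when h carries operations of which one uses the            *)
(* restriction to a subspace (see End_ops and Der_ops).                       *)
Record is_lie2_hom (V0 V1 W0 W1 : lmodType K)
    (g : lie2_ops V0 V1) (h : lie2_ops W0 W1)
    (psi0 : V0 -> W0) (psi1 : V1 -> W1) (psi2 : V0 -> V0 -> W1) : Prop := IsLie2Hom {
  hom_linear0 : linear psi0;
  hom_linear1 : linear psi1;
  hom_bilinear2 : bilinear_map psi2;
  hom_skew2 : skew2 psi2;
  hom_diff : forall a, diff h (psi1 a) = psi0 (diff g a);
  hom_br0 : forall x y,
    psi0 (br0 g x y) - br0 h (psi0 x) (psi0 y) = diff h (psi2 x y);
  hom_br1 : forall x a,
    psi1 (br1 g x a) - br1 h (psi0 x) (psi1 a) = psi2 x (diff g a);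
  hom_jac : forall x y z,
    cyc (fun x y z => br1 h (psi0 x) (psi2 y z)) x y z
      + jac h (psi0 x) (psi0 y) (psi0 z)
    = cyc (fun x y z => psi2 (br0 g x y) z) x y z + psi1 (jac g x y z)
}.

End Lie2Algebra.

Section EndDer.
Variable K : fieldType.

(* The elements (X_0, X_1) of degree 0 and the elements X + l_X of degree 0,  *)
(* the latter being encoded as ((X_0, X_1), l_X), before any condition is     *)
(* imposed on them.                                                           *)
Definition maps (U0 U1 V0 V1 : lmodType K) : lmodType K :=
  ((U0 -> V0) * (U1 -> V1))%type.
Definition cochain (U0 U1 V0 V1 : lmodType K) : lmodType K :=
  (((U0 -> V0) * (U1 -> V1)) * (U0 -> U0 -> V1))%type.

Section Cochain.
Variables (U0 U1 V0 V1 : lmodType K) (X : cochain U0 U1 V0 V1).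
Definition c0 : U0 -> V0 := X.1.1.
Definition c1 : U1 -> V1 := X.1.2.
Definition cl : U0 -> U0 -> V1 := X.2.
End Cochain.

Section End.
Variables (V0 V1 : lmodType K) (dV : V1 -> V0).

Definition End_delta (T : V0 -> V1) : maps V0 V1 V0 V1 :=
  (fun u => dV (T u), fun v => T (dV v)).
Definition End_br0 (X Y : maps V0 V1 V0 V1) : maps V0 V1 V0 V1 :=
  (fun u => X.1 (Y.1 u) - Y.1 (X.1 u), fun v => X.2 (Y.2 v) - Y.2 (X.2 v)).
Definition End_br1 (X : maps V0 V1 V0 V1) (T : V0 -> V1) : V0 -> V1 :=
  fun u => X.2 (T u) - T (X.1 u).

Record in_End0 (X : maps V0 V1 V0 V1) : Prop := InEnd0 {
  End0_linear0 : linear X.1;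
  End0_linear1 : linear X.2;
  End0_chain : forall v, X.1 (dV v) = dV (X.2 v)
}.

(* End(V) consists of the X such that in_End0 X and of the T such that        *)
(* linear T, with these operations.                                           *)
Definition End_ops : lie2_ops (maps V0 V1 V0 V1) (V0 -> V1) :=
  Lie2Ops End_delta End_br0 End_br1 (fun _ _ _ => 0).

End End.

Section Der.
Variables (m0 m1 : lmodType K) (m : lie2_ops m0 m1).

Definition tri (X : maps m0 m1 m0 m1) (l : m0 -> m0 -> m1) : m0 -> m0 -> m1 :=
  fun u v => X.2 (l u v) - l (X.1 u) v - l u (X.1 v).

Definition Der_diff (T : m0 -> m1) : cochain m0 m1 m0 m1 :=
  (End_delta (diff m) T,
   fun u v => T (br0 m u v) - br1 m u (T v) - br1' m (T u) v).
Definition Der_br0 (X Y : cochain m0 m1 m0 m1) : cochain m0 m1 m0 m1 :=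
  (End_br0 X.1 Y.1, tri X.1 (cl Y) - tri Y.1 (cl X)).
Definition Der_br1 (X : cochain m0 m1 m0 m1) (T : m0 -> m1) : m0 -> m1 :=
  End_br1 X.1 T.

Record in_Der0 (X : cochain m0 m1 m0 m1) : Prop := InDer0 {
  Der0_linear0 : linear (c0 X);
  Der0_linear1 : linear (c1 X);
  Der0_bilinear : bilinear_map (cl X);
  Der0_skew : skew2 (cl X);
  Der0_chain : forall xi, diff m (c1 X xi) = c0 X (diff m xi);
  Der0_br0 : forall u v,
    diff m (cl X u v)
    = c0 X (br0 m u v) - br0 m (c0 X u) v - br0 m u (c0 X v);
  Der0_br1 : forall u xi,
    cl X u (diff m xi)
    = c1 X (br1 m u xi) - br1 m (c0 X u) xi - br1 m u (c1 X xi);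
  Der0_jac : forall u v w,
    c1 X (jac m u v w)
    = cyc (fun u v w => cl X u (br0 m v w) + br1 m u (cl X v w)
                        + jac m (c0 X u) v w) u v w
}.

(* Der(m) consists of the X such that in_Der0 X and of the T such that        *)
(* linear T, with these operations.                                           *)
Definition Der_ops : lie2_ops (cochain m0 m1 m0 m1) (m0 -> m1) :=
  Lie2Ops Der_diff Der_br0 Der_br1 (fun _ _ _ => 0).

End Der.

End EndDer.

Section CrossedModule.
Variables (K : fieldType) (g0 g1 m0 m1 : lmodType K).

Record action (g : lie2_ops g0 g1) (m : lie2_ops m0 m1) := Action {
  phi0 : g0 -> maps m0 m1 m0 m1;
  phi1 : g1 -> m0 -> m1;
  phi2 : g0 -> g0 -> m0 -> m1;
  lphi : g0 -> m0 -> m0 -> m1;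
  phi0_End : forall x, in_End0 (diff m) (phi0 x);
  phi1_linear : forall a, linear (phi1 a);
  phi2_linear : forall x y, linear (phi2 x y);
  phi_hom : is_lie2_hom g (End_ops (diff m)) phi0 phi1 phi2;
  phi0_Der : forall x, in_Der0 m (phi0 x, lphi x);
  phi_hom_Der : is_lie2_hom g (Der_ops m) (fun x => (phi0 x, lphi x)) phi1 phi2
}.

(* x |> u in the degrees 0 and 1 of m. *)
Definition act0 (g : lie2_ops g0 g1) (m : lie2_ops m0 m1) (phi : action g m)
  (x : g0) (u : m0) : m0 := (phi0 phi x).1 u.
Definition act1 (g : lie2_ops g0 g1) (m : lie2_ops m0 m1) (phi : action g m)
  (x : g0) (xi : m1) : m1 := (phi0 phi x).2 xi.

Section CrossedProduct.
Variables (g : lie2_ops g0 g1) (m : lie2_ops m0 m1) (phi : action g m).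

Definition crossed_diff (e : g1 * m1) : g0 * m0 := (diff g e.1, diff m e.2).
Definition crossed_br0 (e f : g0 * m0) : g0 * m0 :=
  (br0 g e.1 f.1, br0 m e.2 f.2 + act0 phi e.1 f.2 - act0 phi f.1 e.2).
Definition crossed_br1 (e : g0 * m0) (f : g1 * m1) : g1 * m1 :=
  (br1 g e.1 f.1, br1 m e.2 f.2 + act1 phi e.1 f.2 - phi1 phi f.1 e.2).
Definition crossed_jac (e f h : g0 * m0) : g1 * m1 :=
  (jac g e.1 f.1 h.1,
   jac m e.2 f.2 h.2
   - phi2 phi e.1 f.1 h.2 - phi2 phi f.1 h.1 e.2 - phi2 phi h.1 e.1 f.2
   + lphi phi e.1 f.2 h.2 + lphi phi f.1 h.2 e.2 + lphi phi h.1 e.2 f.2).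

Definition crossed_ops : lie2_ops (g0 * m0)%type (g1 * m1)%type :=
  Lie2Ops crossed_diff crossed_br0 crossed_br1 crossed_jac.

End CrossedProduct.

Record crossed_module (g : lie2 g0 g1) (m : lie2 m0 m1) := CrossedModule {
  cm_phi : action g m;
  Pi0 : g0 * m0 -> g0;
  Pi1 : g1 * m1 -> g1;
  Pi2 : g0 * m0 -> g0 * m0 -> g1;
  Pi_hom : is_lie2_hom (crossed_ops cm_phi) g Pi0 Pi1 Pi2;
  Pi0_g : forall x, Pi0 (x, 0) = x;
  Pi1_g : forall a, Pi1 (a, 0) = a;
  Pi2_g : forall x y, Pi2 (x, 0) (y, 0) = 0;
  cm_br00 : forall u v, br0 m u v = act0 cm_phi (Pi0 (0, u)) v;
  cm_br01 : forall u xi, br1 m u xi = act1 cm_phi (Pi0 (0, u)) xi;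
  cm_br10 : forall xi v, br1' m xi v = phi1 cm_phi (Pi1 (0, xi)) v;
  cm_jac : forall u v w,
    jac m u v w = - phi2 cm_phi (Pi0 (0, u)) (Pi0 (0, v)) w
                  - phi1 cm_phi (Pi2 (Pi0 (0, u), 0) (0, v)) w;
  cm_lphi : forall x v w,
    lphi cm_phi x v w = - phi2 cm_phi x (Pi0 (0, v)) w
                        - phi1 cm_phi (Pi2 (x, 0) (0, v)) w;
  cm_Pi2l : forall u v, Pi2 (0, u) (0, v) = Pi2 (Pi0 (0, u), 0) (0, v);
  cm_Pi2r : forall u v, Pi2 (0, u) (0, v) = Pi2 (0, u) (Pi0 (0, v), 0)
}.

Section Derivations.
Variables (g : lie2 g0 g1) (m : lie2 m0 m1) (C : crossed_module g m).

Definition varphi0 (u : m0) : g0 := Pi0 C (0, u).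
Definition varphi1 (xi : m1) : g1 := Pi1 C (0, xi).
Definition sigma (x : g0) (u : m0) : g1 := Pi2 C (x, 0) (0, u).
Definition sigma' (u : m0) (x : g0) : g1 := - sigma x u.

Let phi := cm_phi C.

Record is_cocycle (X : cochain g0 g1 m0 m1) : Prop := IsCocycle {
  cocycle_linear0 : linear (c0 X);
  cocycle_linear1 : linear (c1 X);
  cocycle_bilinear : bilinear_map (cl X);
  cocycle_skew : skew2 (cl X);
  cocycle_chain : forall a, c0 X (diff g a) = diff m (c1 X a);
  cocycle_br0 : forall x y,
    diff m (cl X x y)
    = c0 X (br0 g x y) + act0 phi y (c0 X x) - act0 phi x (c0 X y);
  cocycle_br1 : forall x a,
    cl X x (diff g a)
    = c1 X (br1 g x a) + phi1 phi a (c0 X x) - act1 phi x (c1 X a);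
  cocycle_jac : forall x y z,
    c1 X (jac g x y z)
    = cyc (fun x y z => cl X x (br0 g y z) + act1 phi x (cl X y z)
                        - phi2 phi y z (c0 X x)) x y z
}.

(* The differential - D. *)
Definition der_diff (T : g0 -> m1) : cochain g0 g1 m0 m1 :=
  ((fun x => diff m (T x), fun a => T (diff g a)),
   fun x y => T (br0 g x y) - act1 phi x (T y) + act1 phi y (T x)).

Definition der_tri (X Y : cochain g0 g1 m0 m1) : g0 -> g0 -> m1 :=
  fun x y => c1 X (varphi1 (cl Y x y)) - cl Y (varphi0 (c0 X x)) y
             - cl Y x (varphi0 (c0 X y)).
Definition der_omega (X Y : cochain g0 g1 m0 m1) : g0 -> g0 -> m1 :=
  fun x y => c1 X (sigma' (c0 Y x) y) + c1 X (sigma x (c0 Y y))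
             - c1 Y (sigma' (c0 X x) y) - c1 Y (sigma x (c0 X y)).

Definition der_br0 (X Y : cochain g0 g1 m0 m1) : cochain g0 g1 m0 m1 :=
  ((fun x => c0 X (varphi0 (c0 Y x)) - c0 Y (varphi0 (c0 X x)),
    fun a => c1 X (varphi1 (c1 Y a)) - c1 Y (varphi1 (c1 X a))),
   der_tri X Y - der_tri Y X + der_omega X Y).

Definition der_br1 (X : cochain g0 g1 m0 m1) (T : g0 -> m1) : g0 -> m1 :=
  fun x => c1 X (varphi1 (T x)) - T (varphi0 (c0 X x)).

Definition cocycles : {pred cochain g0 g1 m0 m1} := fun X => `[< is_cocycle X >].

End Derivations.

Definition linear_maps : {pred (g0 -> m1)} := fun T => `[< linear T >].

Lemma linear_maps_closed : submod_closed linear_maps.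
Proof.
split=> [|k S T /asboolP linS /asboolP linT]; apply/asboolP => a u v.
  by rewrite scaler0 addr0.
have E w : (k *: S + T) w = k *: S w + T w by [].
rewrite !E linS linT !scalerDr !scalerA (mulrC k a) -!addrA; congr (_ + _).
by rewrite addrCA.
Qed.

Section DerClosed.
Variables (g : lie2 g0 g1) (m : lie2 m0 m1) (C : crossed_module g m).

Let phi := cm_phi C.

Lemma comb_add (V : lmodType K) k (u u' v v' : V) :
  (k *: u + v) + (k *: u' + v') = k *: (u + u') + (v + v').
Proof. by rewrite scalerDr addrACA. Qed.

Lemma comb_sub (V : lmodType K) k (u u' v v' : V) :
  (k *: u + v) - (k *: u' + v') = k *: (u - u') + (v - v').
Proof. by rewrite scalerBr opprD addrACA. Qed.

Lemma comb_linear (U V : lmodType K) k (S T : U -> V) :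
  linear S -> linear T -> linear (fun u => k *: S u + T u).
Proof.
move=> linS linT a u v; rewrite linS linT !scalerDr !scalerA (mulrC k a) -!addrA.
by congr (_ + _); rewrite addrCA.
Qed.

Lemma act0_linear x : linear (act0 phi x).
Proof. exact: End0_linear0 (phi0_End phi x). Qed.

Lemma act1_linear x : linear (act1 phi x).
Proof. exact: End0_linear1 (phi0_End phi x). Qed.

Lemma linear_fun0 (U V : lmodType K) (f : U -> V) : linear f -> f 0 = 0.
Proof. by move=> /(_ (-1) 0 0); rewrite scaler0 addr0 scaleN1r addNr. Qed.

Lemma cocycles_closed : submod_closed (cocycles C).
Proof.
have d0 := linear_fun0 (lie2_diff_linear (lie2P m)).
have a0 x := linear_fun0 (act0_linear x); have a1 x := linear_fun0 (act1_linear x).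
have p1 a := linear_fun0 (phi1_linear phi a).
have p2 x y := linear_fun0 (phi2_linear phi x y).
split=> [|k X Y /asboolP hX /asboolP hY]; apply/asboolP.
  have e0 x : c0 (0 : cochain g0 g1 m0 m1) x = 0 by [].
  have e1 x : c1 (0 : cochain g0 g1 m0 m1) x = 0 by [].
  have el x y : cl (0 : cochain g0 g1 m0 m1) x y = 0 by [].
  split=> [c u v|c u v||x y|a|x y|x a|x y z].
  - by rewrite !e0 scaler0 addr0.
  - by rewrite !e1 scaler0 addr0.
  - by split=> x c u v; rewrite !el scaler0 addr0.
  - by rewrite !el oppr0.
  - by rewrite e0 e1 d0.
  - by rewrite el !e0 d0 !a0 subr0 addr0.
  - by rewrite el e0 !e1 p1 a1 subr0 addr0.
  - by rewrite e1 /cyc !el !e0 !a1 !p2 !subr0 !addr0.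
have E0 x : c0 (k *: X + Y) x = k *: c0 X x + c0 Y x by [].
have E1 x : c1 (k *: X + Y) x = k *: c1 X x + c1 Y x by [].
have El x y : cl (k *: X + Y) x y = k *: cl X x y + cl Y x y by [].
split=> [||||a|x y|x a|x y z].
- exact: comb_linear (cocycle_linear0 hX) (cocycle_linear0 hY).
- exact: comb_linear (cocycle_linear1 hX) (cocycle_linear1 hY).
- have [lX rX] := cocycle_bilinear hX; have [lY rY] := cocycle_bilinear hY.
  by split=> x; [exact: comb_linear (lX x) (lY x)|exact: comb_linear (rX x) (rY x)].
- move=> x y; rewrite !El (cocycle_skew hX x) (cocycle_skew hY x).
  by rewrite scalerN opprD.
- rewrite E0 E1 (cocycle_chain hX) (cocycle_chain hY).
  by rewrite (lie2_diff_linear (lie2P m)).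
- rewrite El !E0 (lie2_diff_linear (lie2P m)) !act0_linear comb_add comb_sub.
  by rewrite (cocycle_br0 hX) (cocycle_br0 hY).
- rewrite El E0 !E1 act1_linear phi1_linear comb_add comb_sub.
  by rewrite (cocycle_br1 hX) (cocycle_br1 hY).
- rewrite E1 (cocycle_jac hX) (cocycle_jac hY) /cyc !El !E0 !act1_linear.
  by rewrite !phi2_linear !comb_add !comb_sub !comb_add.
Qed.

End DerClosed.

End CrossedModule.

HB.instance Definition _ (K : fieldType) (g0 m1 : lmodType K) :=
  GRing.isSubmodClosed.Build K (g0 -> m1) (@linear_maps K g0 m1)
    (@linear_maps_closed K g0 m1).

Record Der1 (K : fieldType) (g0 m1 : lmodType K) := MkDer1 {
  Der1_val :> g0 -> m1;
  Der1P : Der1_val \in @linear_maps K g0 m1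
}.
HB.instance Definition _ (K : fieldType) (g0 m1 : lmodType K) :=
  [isSub for @Der1_val K g0 m1].
HB.instance Definition _ (K : fieldType) (g0 m1 : lmodType K) :=
  [Choice of Der1 g0 m1 by <:].
HB.instance Definition _ (K : fieldType) (g0 m1 : lmodType K) :=
  [SubChoice_isSubLmodule of Der1 g0 m1 by <:].

HB.instance Definition _ (K : fieldType) (g0 g1 m0 m1 : lmodType K)
    (g : lie2 g0 g1) (m : lie2 m0 m1) (C : crossed_module g m) :=
  GRing.isSubmodClosed.Build K (cochain g0 g1 m0 m1) (cocycles C)
    (cocycles_closed C).

Record Der0 (K : fieldType) (g0 g1 m0 m1 : lmodType K)
    (g : lie2 g0 g1) (m : lie2 m0 m1) (C : crossed_module g m) := MkDer0 {
  Der0_val :> cochain g0 g1 m0 m1;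
  Der0P : Der0_val \in cocycles C
}.
HB.instance Definition _ (K : fieldType) (g0 g1 m0 m1 : lmodType K)
    (g : lie2 g0 g1) (m : lie2 m0 m1) (C : crossed_module g m) :=
  [isSub for @Der0_val K g0 g1 m0 m1 g m C].
HB.instance Definition _ (K : fieldType) (g0 g1 m0 m1 : lmodType K)
    (g : lie2 g0 g1) (m : lie2 m0 m1) (C : crossed_module g m) :=
  [Choice of Der0 C by <:].
HB.instance Definition _ (K : fieldType) (g0 g1 m0 m1 : lmodType K)
    (g : lie2 g0 g1) (m : lie2 m0 m1) (C : crossed_module g m) :=
  [SubChoice_isSubLmodule of Der0 C by <:].

(* Main.v *)
(* Every identity required of the derivations becomes, once all maps are      *)
(* expanded by additivity, an identity between signed sums of terms in an     *)
(* abelian group. It follows from two families of rewriting rules: those      *)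
(* expressing that Pi is a homomorphism (formulas for varphi and sigma on     *)
(* x |> u, x |> xi, a |> u and (x, y) |> u, and the antisymmetry              *)
(* sigma (varphi0 u) v = - sigma (varphi0 v) u), and the Peiffer identities,  *)
(* which turn the brackets of m into actions of g. In the closure of the      *)
(* cocycles under the bracket, the terms that do not cancel directly are      *)
(* symmetric in X and Y; for the last cocycle condition this uses that        *)
(* l_{phi0(z)} (Y x) (X y) is skew and expressed by phi2 and sigma.           *)

Require Import Defs.
From mathcomp Require Import all_boot all_algebra.
From mathcomp Require Import boolp.
Set Implicit Arguments.
Unset Strict Implicit.
Unset Printing Implicit Defensive.
Import GRing.Theory.
Local Open Scope ring_scope.

(** Composition through [varphi], sending X and Y to X o varphi o Y, is associative. The brackets of
    derivations are its commutators, corrected in the component [cl]. As [varphi] and the cocycles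
    commute with the differentials, all identities for the components [c0], [c1] and for maps of
    degree 1 are formal; the work lies in [cl] and in closure. Evaluating the homomorphism
    conditions of Pi on elements of g and of m shows that [sigma] measures how far [varphi] is from
    being equivariant. The term omega^sigma compensates this defect, and the Peiffer identities
    remove the rest: this gives closure under the bracket ([der_br0_cocycle]). That -D(T) is a
    cocycle ([der_diff_cocycle]) comes from the Jacobi identity of g and the action laws. For [cl],
    compatibility with the differential is [cl_der_diff_br1], and the Jacobi identity
    ([cl_der_br0_jacobi]) rests on the antisymmetry [sigma_swap]. *)

(* Reflexive normalization of signed sums: the tactic ring does not apply, for *)
(* lack of a product on a zmodType.                                            *)
Inductive zexp := ZAtom of nat | ZZero | ZAdd of zexp & zexp | ZOpp of zexp.

Fixpoint zeval (V : zmodType) (env : seq V) (e : zexp) : V :=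
  match e with
  | ZAtom n => nth 0 env n
  | ZZero => 0
  | ZAdd e1 e2 => zeval env e1 + zeval env e2
  | ZOpp e1 => - zeval env e1
  end.

Fixpoint zcoef (e : zexp) (i : nat) : int :=
  match e with
  | ZAtom n => if n == i then 1 else 0
  | ZZero => 0
  | ZAdd e1 e2 => intZmod.addz (zcoef e1 i) (zcoef e2 i)
  | ZOpp e1 => intZmod.oppz (zcoef e1 i)
  end.

Lemma zevalE (V : zmodType) (env : seq V) (e : zexp) :
  zeval env e = \sum_(i < size env) nth 0 env i *~ zcoef e i.
Proof.
elim: e => [n||e1 IH1 e2 IH2|e IH] /=.
- have [lt_n|le_n] := ltnP n (size env).
    rewrite (bigD1 (Ordinal lt_n)) //= eqxx mulr1z big1 ?addr0 // => i.
    by rewrite eq_sym -val_eqE /= => /negPf ->.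
  (* An index beyond [env] evaluates to the default 0, and its coefficient vanishes at every index
     of the sum. *)
  rewrite nth_default // big1 // => i _; rewrite (gtn_eqF (leq_trans _ le_n)) //.
- by rewrite big1.
- rewrite IH1 IH2 -big_split; apply: eq_bigr => i _; apply/esym/mulrzDr_tmp.
- by rewrite IH -sumrN; apply: eq_bigr => i _; rewrite -mulrNz.
Qed.

(** The atoms are treated as independent, so the test accepts only identities valid in every abelian
    group. *)
Lemma zeval_eq (V : zmodType) (env : seq V) (e1 e2 : zexp) :
  all (fun i => zcoef e1 i == zcoef e2 i) (iota 0 (size env)) ->
  zeval env e1 = zeval env e2.
Proof.
move=> /allP eq12; rewrite !zevalE; apply: eq_bigr => i _.
by congr (_ *~ _); apply/eqP/eq12; rewrite mem_iota /= add0n.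
Qed.

Ltac zindex a env :=
  lazymatch env with
  | a :: _ => constr:(0%N)
  | _ :: ?env' => let n := zindex a env' in constr:(n.+1)
  end.

Ltac zmem a env :=
  lazymatch env with
  | nil => constr:(false)
  | a :: _ => constr:(true)
  | _ :: ?env' => zmem a env'
  end.

Ltac zatoms t env :=
  lazymatch t with
  | @GRing.add _ ?a ?b => let env' := zatoms a env in zatoms b env'
  | @GRing.opp _ ?a => zatoms a env
  | @GRing.zero _ => env
  | _ => lazymatch zmem t env with true => env | false => constr:(t :: env) end
  end.

Ltac zquote t env :=
  lazymatch t with
  | @GRing.add _ ?a ?b =>
      let a' := zquote a env in let b' := zquote b env in constr:(ZAdd a' b')
  | @GRing.opp _ ?a => let a' := zquote a env in constr:(ZOpp a')
  | @GRing.zero _ => constr:(ZZero)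
  | _ => let n := zindex t env in constr:(ZAtom n)
  end.

Ltac zmod :=
  lazymatch goal with
  | |- @eq ?V ?a ?b =>
      let env := zatoms a (@nil V) in
      let env := zatoms b env in
      let a' := zquote a env in
      let b' := zquote b env in
      change (zeval env a' = zeval env b'); apply: zeval_eq; vm_compute; reflexivity
  end.

(** * Additivity of linear maps *)

Section LinearMaps.
Variables (K : fieldType) (U V : lmodType K) (f : U -> V) (lin_f : linear f).

Lemma linear_funD x y : f (x + y) = f x + f y.
Proof. by have := lin_f 1 x y; rewrite !scale1r. Qed.

Lemma linear_funN x : f (- x) = - f x.
Proof. by have := lin_f (-1) x 0; rewrite (linear_fun0 lin_f) !addr0 !scaleN1r. Qed.

Definition linear_funE := (linear_funD, linear_funN, linear_fun0 lin_f).

End LinearMaps.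

Lemma linear_comp (K : fieldType) (U V W : lmodType K) (h : V -> W) (k : U -> V) :
  linear h -> linear k -> linear (fun u => h (k u)).
Proof. by move=> lin_h lin_k c u v; rewrite lin_k lin_h. Qed.

Lemma linear_add (K : fieldType) (U V : lmodType K) (h k : U -> V) :
  linear h -> linear k -> linear (fun u => h u + k u).
Proof. by move=> lin_h lin_k c u v; rewrite lin_h lin_k comb_add. Qed.

Lemma linear_sub (K : fieldType) (U V : lmodType K) (h k : U -> V) :
  linear h -> linear k -> linear (fun u => h u - k u).
Proof. by move=> lin_h lin_k c u v; rewrite lin_h lin_k comb_sub. Qed.

Lemma bilinear_skew (K : fieldType) (U W : lmodType K) (h : U -> U -> W) :
  (forall x, linear (h x)) -> skew2 h -> bilinear_map h.
Proof.
move=> lin_h skew_h; split=> // y c u v.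
by rewrite skew_h lin_h opprD -scalerN -!(skew_h _ y).
Qed.

Section CrossedModuleTheory.
Variables (K : fieldType) (g0 g1 m0 m1 : lmodType K).
Variables (g : lie2 g0 g1) (m : lie2 m0 m1) (C : crossed_module g m).

Local Notation dg := (diff g).
Local Notation dm := (diff m).
Local Notation b0 := (br0 g).
Local Notation b1 := (br1 g).
Local Notation p := (act0 (cm_phi C)).
Local Notation q := (act1 (cm_phi C)).
Local Notation r := (phi1 (cm_phi C)).
Local Notation s := (phi2 (cm_phi C)).
Local Notation l := (lphi (cm_phi C)).
Local Notation f0 := (varphi0 C).
Local Notation f1 := (varphi1 C).
Local Notation sg := (sigma C).

Let gP := lie2P g.
Let mP := lie2P m.
Let endP := phi_hom (cm_phi C).
Let PiP := Pi_hom C.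

(** * Linearity of the structure maps of the crossed module *)

Lemma br0_linear_l y : linear (b0^~ y).
Proof. exact: (lie2_br0_bilinear gP).2. Qed.

Lemma br0_linear_r x : linear (b0 x).
Proof. exact: (lie2_br0_bilinear gP).1. Qed.

Lemma br1_linear_r x : linear (b1 x).
Proof. exact: (lie2_br1_bilinear gP).1. Qed.

Lemma act0_linear_l u : linear (p^~ u).
Proof. by move=> k x y; rewrite /act0 (hom_linear0 endP). Qed.

Lemma act1_linear_l xi : linear (q^~ xi).
Proof. by move=> k x y; rewrite /act1 (hom_linear0 endP). Qed.

Lemma phi1_linear_l u : linear (r^~ u).
Proof. by move=> k a b; rewrite (hom_linear1 endP). Qed.

Lemma varphi0_linear : linear f0.
Proof.
move=> k u v; rewrite /varphi0 -(hom_linear0 PiP); congr (Pi0 C (_, _)).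
by rewrite /= scaler0 addr0.
Qed.

Lemma varphi1_linear : linear f1.
Proof.
move=> k u v; rewrite /varphi1 -(hom_linear1 PiP); congr (Pi1 C (_, _)).
by rewrite /= scaler0 addr0.
Qed.

Lemma sigma_linear_r x : linear (sg x).
Proof.
move=> k u v; rewrite /sigma -((hom_bilinear2 PiP).1 _).
by congr (Pi2 C _ (_, _)); rewrite /= scaler0 addr0.
Qed.

Lemma sigma_linear_l u : linear (sg^~ u).
Proof.
move=> k x y; rewrite /sigma -((hom_bilinear2 PiP).2 _).
by congr (Pi2 C (_, _) _); rewrite /= scaler0 addr0.
Qed.

(** Repeated rewriting with these rules distributes the structure maps over signed sums, the form
    that [zmod] handles. *)
Definition opsE :=
  ((linear_funE (lie2_diff_linear gP), linear_funE (lie2_diff_linear mP),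
    linear_funE varphi0_linear, linear_funE varphi1_linear),
   (fun y => linear_funE (br0_linear_l y), fun x => linear_funE (br0_linear_r x),
    fun x => linear_funE (br1_linear_r x),
    fun x => linear_funE (act0_linear C x),
    fun x => linear_funE (act1_linear C x)),
   (fun u => linear_funE (act0_linear_l u), fun a => linear_funE (act1_linear_l a),
    fun u => linear_funE (phi1_linear_l u),
    fun a => linear_funE (phi1_linear (cm_phi C) a),
    fun x y => linear_funE (phi2_linear (cm_phi C) x y)),
   (fun x => linear_funE (sigma_linear_r x), fun u => linear_funE (sigma_linear_l u))).

(** * The homomorphism Pi in terms of [varphi] and [sigma] *)

Lemma diff_varphi1 xi : dg (f1 xi) = f0 (dm xi).
Proof.
by rewrite (hom_diff PiP) /= /crossed_diff /= (linear_fun0 (lie2_diff_linear gP)).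
Qed.

Lemma Pi2_mixed_swap u x : Pi2 C (0, u) (x, 0) = - sg x u.
Proof. by rewrite (hom_skew2 PiP). Qed.

(** By condition (iv) of a crossed module, both sides equal [Pi2 C (0, u) (0, v)]. *)
Lemma sigma_swap u v : sg (f0 u) v = - sg (f0 v) u.
Proof. by rewrite -Pi2_mixed_swap -cm_Pi2r cm_Pi2l. Qed.

Lemma diff_sigma x u : dg (sg x u) = f0 (p x u) - b0 x (f0 u).
Proof.
rewrite /sigma -(hom_br0 PiP) Pi0_g /= /crossed_br0 /=.
rewrite (linear_fun0 (br0_linear_r x)).
rewrite (linear_fun0 ((lie2_br0_bilinear mP).2 u)).
by rewrite (linear_fun0 (act0_linear_l _)) subr0 add0r.
Qed.

Lemma sigma_diff x xi : sg x (dm xi) = f1 (q x xi) - b1 x (f1 xi).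
Proof.
have := hom_br1 PiP (x, 0) (0, xi).
rewrite /= /crossed_br1 /crossed_diff /= Pi0_g.
rewrite (linear_fun0 (br1_linear_r x)) (linear_fun0 (lie2_diff_linear gP)).
rewrite (linear_fun0 ((lie2_br1_bilinear mP).2 xi)).
by rewrite (linear_fun0 (phi1_linear_l _)) subr0 add0r => /esym.
Qed.

Lemma sigma_diff_l a u : sg (dg a) u = f1 (r a u) + b1 (f0 u) a.
Proof.
have := hom_br1 PiP (0, u) (a, 0).
rewrite /= /crossed_br1 /crossed_diff /= Pi1_g.
rewrite (linear_fun0 ((lie2_br1_bilinear gP).2 a)) (linear_fun0 (lie2_diff_linear mP)).
rewrite (linear_fun0 ((lie2_br1_bilinear mP).1 u)).
rewrite (linear_fun0 (act1_linear C _)) Pi2_mixed_swap.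
rewrite addr0 add0r -[Pi1 C _]/(f1 _) -[Pi0 C _]/(f0 _) !opsE => /eqP.
by rewrite -opprD eqr_opp => /eqP.
Qed.

(** The Jacobiator of the crossed product at [(x, 0)], [(y, 0)], [(0, u)] has m-component
    [- s x y u], so the last homomorphism condition of Pi can be solved for its image. *)
Lemma varphi1_phi2 x y u :
  f1 (s x y u) = sg (b0 x y) u - sg x (p y u) + sg y (p x u)
                 - b1 x (sg y u) + b1 y (sg x u) - jac g x y (f0 u).
Proof.
have b0m0 v := linear_fun0 ((lie2_br0_bilinear mP).1 v).
have b0m0' v := linear_fun0 ((lie2_br0_bilinear mP).2 v).
have Exy : br0 (crossed_ops (cm_phi C)) (x, 0) (y, 0) = (b0 x y, 0).
  by rewrite /= /crossed_br0 /= b0m0 !opsE !addr0 subr0.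
have Eyu : br0 (crossed_ops (cm_phi C)) (y, 0) (0, u) = (0, p y u).
  by rewrite /= /crossed_br0 /= b0m0' !opsE subr0 add0r.
have Eux : br0 (crossed_ops (cm_phi C)) (0, u) (x, 0) = (0, - p x u).
  by rewrite /= /crossed_br0 /= b0m0 !opsE addr0 add0r.
have Ejac : jac (crossed_ops (cm_phi C)) (x, 0) (y, 0) (0, u)
          = (jac g x y 0, - s x y u).
  have jac0 v w : jac m v 0 w = 0.
    by have [_ jl _] := lie2_jac_trilinear mP; rewrite (linear_fun0 (jl _ _)).
  have l0 v w : l v w 0 = 0.
    exact: linear_fun0 ((Der0_bilinear (phi0_Der (cm_phi C) v)).1 w).
  have l0' v w : l v 0 w = 0.
    exact: linear_fun0 ((Der0_bilinear (phi0_Der (cm_phi C) v)).2 w).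
  by rewrite /= /crossed_jac /= jac0 l0 !l0' !opsE !subr0 !addr0 add0r.
have jac0 : jac g x y 0 = 0.
  by have [jl _ _] := lie2_jac_trilinear gP; rewrite (linear_fun0 (jl _ _)).
have := hom_jac PiP (x, 0) (y, 0) (0, u).
rewrite Ejac jac0 /cyc Exy Eyu Eux !Pi0_g !Pi2_mixed_swap Pi2_g.
rewrite -![Pi2 C (_, 0) (0, _)]/(sg _ _) -[Pi1 C _]/(f1 _) -[Pi0 C _]/(f0 _) !opsE.
set a := b1 x _; set b := b1 y _; set c := jac g _ _ _; set d := sg _ _.
rewrite opprK addr0 => /eqP; rewrite -subr_eq0 => /eqP E.
(* Subtracting the vanishing sum [E] leaves a formal identity. *)
rewrite -[LHS]subr0 -{}E; zmod.
Qed.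

(** * Action laws and Peiffer identities *)

Lemma act1_bracket x y xi : q (b0 x y) xi = q x (q y xi) - q y (q x xi) + s x y (dm xi).
Proof.
have /(congr1 (fun X => X.2 xi)) /= <- := hom_br0 endP x y.
by rewrite addrC; apply/esym/subrK.
Qed.

Lemma phi1_diff a xi : r a (dm xi) = q (dg a) xi.
Proof. by have /(congr1 (fun X => X.2 xi)) := hom_diff endP a. Qed.

Lemma diff_act1 x xi : dm (q x xi) = p x (dm xi).
Proof. by rewrite -(End0_chain (phi0_End (cm_phi C) x)). Qed.

Lemma phi2_skew x y u : s x y u = - s y x u.
Proof. by rewrite (hom_skew2 endP). Qed.

Lemma lphi_skew x u v : l x u v = - l x v u.
Proof. exact: (Der0_skew (phi0_Der (cm_phi C) x)). Qed.

(** Condition (i) turns both sides into brackets of m, which are skew; likewise for [peiffer10]. *)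
Lemma peiffer00 u v : p (f0 u) v = - p (f0 v) u.
Proof. by rewrite -!cm_br00 (lie2_br0_skew mP). Qed.

Lemma peiffer10 xi u : r (f1 xi) u = - q (f0 u) xi.
Proof. by rewrite -cm_br10 -cm_br01. Qed.

(** * Closure of the cocycles under the differential and the bracket *)

Definition cocycleE (X : cochain g0 g1 m0 m1) (hX : is_cocycle C X) :=
  (linear_funE (cocycle_linear0 hX), linear_funE (cocycle_linear1 hX),
   fun x => linear_funE ((cocycle_bilinear hX).1 x),
   fun y => linear_funE ((cocycle_bilinear hX).2 y)).

Lemma der_diff_cocycle (T : g0 -> m1) : linear T -> is_cocycle C (der_diff C T).
Proof.
move=> linT; have TE := linear_funE linT.
have skewT : skew2 (cl (der_diff C T)).
  by move=> x y; rewrite /cl /= (lie2_br0_skew gP x y) TE; zmod.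
split=> [||||a|x y|x a|x y z].
- exact: linear_comp (lie2_diff_linear mP) linT.
- exact: linear_comp linT (lie2_diff_linear gP).
- apply: bilinear_skew => // x; apply: linear_add; last first.
    exact: linear_comp (act1_linear_l (T x)) _.
  apply: linear_sub; first exact: linear_comp linT (br0_linear_r x).
  exact: linear_comp (act1_linear C x) linT.
- exact: skewT.
- by [].
- by rewrite /cl /c0 /= !opsE !diff_act1; zmod.
- rewrite /cl /c0 /c1 /= (lie2_diff_br gP) phi1_diff; zmod.
- rewrite /cl /c0 /c1 /cyc /= !opsE !act1_bracket.
  have /(congr1 T) := lie2_jacobi0 gP x y z; rewrite /cyc !TE => /eqP.
  rewrite -subr_eq0 opprK => /eqP E.
  (* Nested brackets are put in the form occurring in [E], the image under [T] of the Jacobi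
     identity. *)
  rewrite (lie2_br0_skew gP x (b0 y z)) (lie2_br0_skew gP y (b0 z x)).
  rewrite (lie2_br0_skew gP z (b0 x y)) !TE -[LHS]subr0 -{}E; zmod.
Qed.

Section Bracket.
Variables (X Y : cochain g0 g1 m0 m1) (hX : is_cocycle C X) (hY : is_cocycle C Y).

Local Notation X0 := (c0 X).
Local Notation X1 := (c1 X).
Local Notation Xl := (cl X).
Local Notation Y0 := (c0 Y).
Local Notation Y1 := (c1 Y).
Local Notation Yl := (cl Y).

(** Working form of the bracket: [sigma'] is eliminated and its sign taken out of [X1] and [Y1]. *)
Lemma cl_der_br0 x y : cl (der_br0 C X Y) x y =
  X1 (f1 (Yl x y)) - Yl (f0 (X0 x)) y - Yl x (f0 (X0 y))
  - (Y1 (f1 (Xl x y)) - Xl (f0 (Y0 x)) y - Xl x (f0 (Y0 y)))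
  + (X1 (sg x (Y0 y)) - X1 (sg y (Y0 x)) - (Y1 (sg x (X0 y)) - Y1 (sg y (X0 x)))).
Proof.
rewrite /cl /= -![_.2]/(cl _) /der_tri /der_omega /sigma'.
rewrite -[LHS]/(X1 (f1 (Yl x y)) - Yl (f0 (X0 x)) y - Yl x (f0 (X0 y))
  - (Y1 (f1 (Xl x y)) - Xl (f0 (Y0 x)) y - Xl x (f0 (Y0 y)))
  + (X1 (- sg y (Y0 x)) + X1 (sg x (Y0 y)) - Y1 (- sg y (X0 x)) - Y1 (sg x (X0 y)))).
by rewrite !(cocycleE hX) !(cocycleE hY); zmod.
Qed.

Lemma c0_der_br0 x : c0 (der_br0 C X Y) x = X0 (f0 (Y0 x)) - Y0 (f0 (X0 x)).
Proof. by []. Qed.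

Lemma c1_der_br0 a : c1 (der_br0 C X Y) a = X1 (f1 (Y1 a)) - Y1 (f1 (X1 a)).
Proof. by []. Qed.

(** The chain condition carries [dm] through [X1] and [Y1] onto [f1] and [sg]. The surviving terms,
    such as [p (f0 (X0 x)) (Y0 y)], cancel in pairs by [peiffer00]. *)
Lemma der_br0_br0 x y :
  dm (cl (der_br0 C X Y) x y)
  = c0 (der_br0 C X Y) (b0 x y) + p y (c0 (der_br0 C X Y) x)
    - p x (c0 (der_br0 C X Y) y).
Proof.
rewrite cl_der_br0 !c0_der_br0 !opsE.
rewrite -!(cocycle_chain hX) -!(cocycle_chain hY) !diff_varphi1 !diff_sigma.
rewrite !(cocycle_br0 hX) !(cocycle_br0 hY) !(opsE, cocycleE hX, cocycleE hY).
rewrite !(peiffer00 (Y0 _)) !(lie2_br0_skew gP (f0 _)) !(cocycleE hX, cocycleE hY).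
zmod.
Qed.

Lemma der_br0_br1 x a :
  cl (der_br0 C X Y) x (dg a)
  = c1 (der_br0 C X Y) (b1 x a) + r a (c0 (der_br0 C X Y) x)
    - q x (c1 (der_br0 C X Y) a).
Proof.
rewrite cl_der_br0 !c0_der_br0 !c1_der_br0 !opsE.
rewrite (cocycle_chain hX) (cocycle_chain hY) -!diff_varphi1.
rewrite !(cocycle_br1 hX) !(cocycle_br1 hY) !sigma_diff !sigma_diff_l.
rewrite !(opsE, cocycleE hX, cocycleE hY) !peiffer10.
zmod.
Qed.

(** The left side is [X1 (f1 _)] applied to the condition for [Y], minus the same with X and Y
    exchanged. Pushing [f1] inside leaves [X1] on brackets and [jac] terms, to which the conditions
    for [X] apply. *)
Lemma der_br0_jac x y z :
  c1 (der_br0 C X Y) (jac g x y z)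
  = cyc (fun x y z => cl (der_br0 C X Y) x (b0 y z)
                      + q x (cl (der_br0 C X Y) y z)
                      - s y z (c0 (der_br0 C X Y) x)) x y z.
Proof.
have f1q t xi : f1 (q t xi) = sg t (dm xi) + b1 t (f1 xi).
  by rewrite sigma_diff subrK.
have c1b1 Z t a : is_cocycle C Z ->
    c1 Z (b1 t a) = cl Z t (dg a) - r a (c0 Z t) + q t (c1 Z a).
  by move=> hZ; rewrite (cocycle_br1 hZ); zmod.
have rsg t u v : r (sg t u) v = - s t (f0 u) v - l t u v.
  rewrite (cm_lphi C) -/(sigma C t u) -/(varphi0 C u); zmod.
rewrite /cyc !cl_der_br0 !c0_der_br0 !c1_der_br0.
rewrite (cocycle_jac hX) (cocycle_jac hY) /cyc.
rewrite !(opsE, cocycleE hX, cocycleE hY) !f1q !varphi1_phi2.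
rewrite !(opsE, cocycleE hX, cocycleE hY) !(c1b1 _ _ _ hX) !(c1b1 _ _ _ hY).
(* A second use: [varphi1_phi2] created terms such as [X1 (jac g y z (f0 (Y0 x)))]. *)
rewrite !(cocycle_jac hX) !(cocycle_jac hY) /cyc !diff_varphi1 !diff_sigma.
rewrite !(cocycle_br0 hX) !(cocycle_br0 hY) !(opsE, cocycleE hX, cocycleE hY).
(* The terms phi2 and l left by rsg cancel with those where X and Y are       *)
(* exchanged, l being skew.                                                   *)
rewrite !peiffer10 !rsg !(phi2_skew (f0 _)) !(lphi_skew _ (Y0 _)).
rewrite !(lie2_br0_skew gP (f0 _)) !(cocycleE hX, cocycleE hY).
zmod.
Qed.

Lemma der_br0_skew : skew2 (cl (der_br0 C X Y)).
Proof.
move=> x y; rewrite !cl_der_br0 (cocycle_skew hX y x) (cocycle_skew hY y x).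
rewrite (cocycle_skew hX x (f0 _)) (cocycle_skew hX y (f0 _)).
rewrite (cocycle_skew hY x (f0 _)) (cocycle_skew hY y (f0 _)).
rewrite !(opsE, cocycleE hX, cocycleE hY); zmod.
Qed.

Lemma der_br0_cocycle : is_cocycle C (der_br0 C X Y).
Proof.
have [lX0 lY0] := (cocycle_linear0 hX, cocycle_linear0 hY).
have [lX1 lY1] := (cocycle_linear1 hX, cocycle_linear1 hY).
have [[lXl _] [lYl _]] := (cocycle_bilinear hX, cocycle_bilinear hY).
have [lf0 lf1] := (varphi0_linear, varphi1_linear).
split.
- by apply: linear_sub; [apply: (linear_comp lX0) | apply: (linear_comp lY0)];
    exact: linear_comp.
- by apply: linear_sub; [apply: (linear_comp lX1) | apply: (linear_comp lY1)];
    exact: linear_comp.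
- apply: bilinear_skew der_br0_skew => x k u v; rewrite !cl_der_br0.
  rewrite !(lYl, lXl, lX0, lY0, lf0, lf1, sigma_linear_r, sigma_linear_l, lX1, lY1).
  by rewrite !(comb_sub, comb_add).
- exact: der_br0_skew.
- by move=> a; rewrite !c0_der_br0 !c1_der_br0
    !(cocycle_chain hX, cocycle_chain hY) -!diff_varphi1
    !(cocycle_chain hX, cocycle_chain hY) !opsE.
- exact: der_br0_br0.
- exact: der_br0_br1.
- exact: der_br0_jac.
Qed.

Lemma der_br1_linear (T : g0 -> m1) : linear T -> linear (der_br1 C X T).
Proof.
move=> lT; apply: linear_sub.
  exact: linear_comp (cocycle_linear1 hX) (linear_comp varphi1_linear lT).
exact: linear_comp lT (linear_comp varphi0_linear (cocycle_linear0 hX)).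
Qed.

Lemma cl_der_diff (T : g0 -> m1) x y :
  cl (der_diff C T) x y = T (b0 x y) - q x (T y) + q y (T x).
Proof. by []. Qed.

End Bracket.

(** * Lie 2-algebra identities in the component [cl] *)

Lemma cl_der_diff_br1 X (T : g0 -> m1) x y : is_cocycle C X -> linear T ->
  cl (der_diff C (der_br1 C X T)) x y = cl (der_br0 C X (der_diff C T)) x y.
Proof.
move=> hX linT; have TE := linear_funE linT; have hT := der_diff_cocycle linT.
rewrite (cl_der_br0 hX hT) !cl_der_diff /der_br1 /c0 /c1 /= -![_.1.1]/(c0 _).
rewrite -![_.1.2]/(c1 _) !diff_varphi1 (cocycle_br0 hX) !diff_sigma !sigma_diff.
(* [f0 (dm _)] is [dg (f1 _)]; moved to the second slot, it is in reach of [cocycle_br1]. *)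
rewrite (cocycle_skew hX (f0 (dm _))) -!diff_varphi1 !(cocycle_br1 hX).
rewrite (lie2_br0_skew gP (f0 _)).
by rewrite !(opsE, cocycleE hX, TE) !peiffer10; zmod.
Qed.

Lemma cl_der_br0_jacobi X Y Z x y :
  is_cocycle C X -> is_cocycle C Y -> is_cocycle C Z ->
  cyc (fun X Y Z => cl (der_br0 C (der_br0 C X Y) Z) x y) X Y Z = 0.
Proof.
move=> hX hY hZ.
have [hXY hYZ hZX] := And3 (der_br0_cocycle hX hY) (der_br0_cocycle hY hZ)
  (der_br0_cocycle hZ hX).
rewrite /cyc (cl_der_br0 hXY hZ) (cl_der_br0 hYZ hX) (cl_der_br0 hZX hY).
rewrite !(cl_der_br0 hX hY) !(cl_der_br0 hY hZ) !(cl_der_br0 hZ hX).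
rewrite !c0_der_br0 !c1_der_br0.
(* Evaluating one bracket at [f0] of another derivation creates terms [sg (f0 _) _] between two
   derivations. Ordering these as X, Y, Z makes them cancel. *)
rewrite !(sigma_swap (c0 Z _) (c0 Y _)) !(sigma_swap (c0 Z _) (c0 X _)).
rewrite !(sigma_swap (c0 Y _) (c0 X _)).
rewrite !(opsE, cocycleE hX, cocycleE hY, cocycleE hZ).
zmod.
Qed.

End CrossedModuleTheory.

(** * The strict Lie 2-algebra of derivations *)

Section DerivationLie2.
Variables (K : fieldType) (g0 g1 m0 m1 : lmodType K).
Variables (g : lie2 g0 g1) (m : lie2 m0 m1) (C : crossed_module g m).

Implicit Types (X Y Z : Der0 C) (T : Der1 g0 m1).

Local Notation f0 := (varphi0 C).
Local Notation f1 := (varphi1 C).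

Lemma cochain_ext (U0 U1 V0 V1 : lmodType K) (X Y : cochain U0 U1 V0 V1) :
  c0 X =1 c0 Y -> c1 X =1 c1 Y -> (forall x, cl X x =1 cl Y x) -> X = Y.
Proof.
case: X Y => [[X0 X1] Xl] [[Y0 Y1] Yl] eq0 eq1 eql.
congr (_, _, _); apply: funext => x; rewrite ?(eq0, eq1) //.
exact/funext/eql.
Qed.

Lemma Der0_cocycle X : is_cocycle C X.
Proof. by have /asboolP := Der0P X. Qed.

Lemma Der1_linear T : linear T.
Proof. by have /asboolP := Der1P T. Qed.

Let hX := Der0_cocycle.
Let linT := Der1_linear.

Definition Der_lie2_ops : lie2_ops (Der0 C) (Der1 g0 m1) := {|
  diff T := MkDer0 (asboolT (der_diff_cocycle C (linT T)));
  br0 X Y := MkDer0 (asboolT (der_br0_cocycle (hX X) (hX Y)));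
  br1 X T := MkDer1 (asboolT (der_br1_linear (hX X) (linT T)));
  jac _ _ _ := 0
|}.

Local Notation L := Der_lie2_ops.

Lemma Der0_ext X Y :
  c0 X =1 c0 Y -> c1 X =1 c1 Y -> (forall x, cl X x =1 cl Y x) -> X = Y.
Proof. by move=> eq0 eq1 eql; apply/val_inj/cochain_ext. Qed.

Lemma Der1_ext (S T : Der1 g0 m1) : S =1 T -> S = T.
Proof. by move=> eqST; apply/val_inj/funext. Qed.

Lemma Der0_combE k X Y :
  (forall x, c0 (k *: X + Y) x = k *: c0 X x + c0 Y x)
  * (forall a, c1 (k *: X + Y) a = k *: c1 X a + c1 Y a)
  * (forall x y, cl (k *: X + Y) x y = k *: cl X x y + cl Y x y).
Proof. by []. Qed.

Lemma Der0_addE X Y :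
  (forall x, c0 (X + Y) x = c0 X x + c0 Y x)
  * (forall a, c1 (X + Y) a = c1 X a + c1 Y a)
  * (forall x y, cl (X + Y) x y = cl X x y + cl Y x y).
Proof. by []. Qed.

Lemma Der0_oppE X :
  (forall x, c0 (- X) x = - c0 X x) * (forall a, c1 (- X) a = - c1 X a)
  * (forall x y, cl (- X) x y = - cl X x y).
Proof. by []. Qed.

Lemma Der1_combE k (S T : Der1 g0 m1) x : (k *: S + T) x = k *: S x + T x.
Proof. by []. Qed.

Lemma Der1_addE (S T : Der1 g0 m1) x : (S + T) x = S x + T x.
Proof. by []. Qed.

Lemma Der1_oppE T x : (- T) x = - T x.
Proof. by []. Qed.

Lemma Der_c0_diff T x : c0 (diff L T) x = diff m (T x).
Proof. by []. Qed.

Lemma Der_c1_diff T a : c1 (diff L T) a = T (diff g a).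
Proof. by []. Qed.

Lemma Der_c0_br0 X Y x : c0 (br0 L X Y) x = c0 X (f0 (c0 Y x)) - c0 Y (f0 (c0 X x)).
Proof. by []. Qed.

Lemma Der_c1_br0 X Y a : c1 (br0 L X Y) a = c1 X (f1 (c1 Y a)) - c1 Y (f1 (c1 X a)).
Proof. by []. Qed.

Lemma Der_cl_br0 X Y : cl (br0 L X Y) = cl (der_br0 C X Y).
Proof. by []. Qed.

Lemma Der_br1E X T x : br1 L X T x = c1 X (f1 (T x)) - T (f0 (c0 X x)).
Proof. by []. Qed.

Lemma Der_br0_skew : skew2 (br0 L).
Proof.
move=> X Y; apply: Der0_ext => [x|a|x y]; rewrite Der0_oppE.
- by rewrite !Der_c0_br0; zmod.
- by rewrite !Der_c1_br0; zmod.
- by rewrite !Der_cl_br0 !cl_der_br0 //; zmod.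
Qed.

Lemma Der_br0_linear_r X : linear (br0 L X).
Proof.
move=> k Y Z; have [lX0 lX1] := (cocycle_linear0 (hX X), cocycle_linear1 (hX X)).
have [lXl rXl] := cocycle_bilinear (hX X).
have [lf0 lf1] := (varphi0_linear C, varphi1_linear C).
have lsig t := sigma_linear_r C t.
apply: Der0_ext => [x|a|x y]; rewrite Der0_combE.
- by rewrite !Der_c0_br0 !Der0_combE !(lf0, lX0) comb_sub.
- by rewrite !Der_c1_br0 !Der0_combE !(lf1, lX1) comb_sub.
- rewrite !Der_cl_br0 !cl_der_br0 // !Der0_combE.
  by rewrite !(lf0, lf1, lsig, lX0, lX1, lXl, rXl) !(comb_sub, comb_add).
Qed.

Lemma Der_br1_bilinear : bilinear_map (br1 L).
Proof.
split=> [X k S T|T k X Y]; apply: Der1_ext => x; rewrite Der1_combE !Der_br1E.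
  by rewrite !Der1_combE varphi1_linear (cocycle_linear1 (hX X)) comb_sub.
by rewrite !Der0_combE varphi0_linear (linT T) comb_sub.
Qed.

Lemma Der_diff_linear : linear (diff L).
Proof.
move=> k S T; have ldm := lie2_diff_linear (lie2P m).
apply: Der0_ext => [x|a|x y]; rewrite Der0_combE ?cl_der_diff ?Der1_combE.
- exact: ldm.
- by [].
- by rewrite !act1_linear comb_sub comb_add.
Qed.

Lemma Der_is_lie2 : is_lie2 L.
Proof.
split.
- exact: Der_diff_linear.
- exact: bilinear_skew Der_br0_linear_r Der_br0_skew.
- exact: Der_br0_skew.
- exact: Der_br1_bilinear.
- by split=> ? ? ? ? ?; rewrite /= scaler0 addr0.
- by split=> ? ? ?; rewrite /= oppr0.
- move=> X T; apply: Der0_ext => [x|a|x y].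
  + rewrite Der_c0_br0 !Der_c0_diff Der_br1E !(opsE C).
    by rewrite -(cocycle_chain (hX X)) diff_varphi1.
  + rewrite Der_c1_br0 !Der_c1_diff Der_br1E.
    by rewrite (cocycle_chain (hX X)) diff_varphi1.
  + by rewrite Der_cl_br0; apply: cl_der_diff_br1.
(* The bracket of -D(S) with [T] is S f0 dm T - T f0 dm S, antisymmetric in [S] and [T]. *)
- move=> S T; apply: Der1_ext => x; rewrite /br1' Der1_oppE !Der_br1E.
  by rewrite !Der_c0_diff !Der_c1_diff !diff_varphi1; zmod.
- move=> X Y Z; rewrite [jac _ _ _ _]/= (linear_fun0 Der_diff_linear) oppr0.
  apply: Der0_ext => [x|a|x y]; rewrite /cyc !Der0_addE.
  (* Jacobi identity for the commutator of an associative product; only additivity enters. *)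
  + by rewrite -[RHS]/0 !Der_c0_br0 !(opsE C, cocycleE (hX _)); zmod.
  + by rewrite -[RHS]/0 !Der_c1_br0 !(opsE C, cocycleE (hX _)); zmod.
  + exact: cl_der_br0_jacobi.
- move=> X Y T; apply: Der1_ext => x; rewrite /br1' !Der1_addE !Der1_oppE.
  rewrite -[RHS]/(- 0) oppr0 !(Der_br1E, Der1_oppE) Der_c0_br0 Der_c1_br0.
  by rewrite !(opsE C, cocycleE (hX _), linear_funE (linT T)); zmod.
- move=> X Y Z U; have br10 W := linear_fun0 (Der_br1_bilinear.1 W).
  by rewrite ![jac _ _ _ _]/= !br10; zmod.
Qed.

End DerivationLie2.

Theorem theorem4p4 (K : fieldType) (g0 g1 m0 m1 : lmodType K)
    (g : lie2 g0 g1) (m : lie2 m0 m1) (C : crossed_module g m) :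
  exists L : lie2 (Der0 C) (Der1 g0 m1),
    [/\ strict L,
        forall T : Der1 g0 m1, Der0_val (diff L T) = der_diff C (Der1_val T),
        forall X Y : Der0 C,
          Der0_val (br0 L X Y) = der_br0 C (Der0_val X) (Der0_val Y)
      & forall (X : Der0 C) (T : Der1 g0 m1),
          Der1_val (br1 L X T) = der_br1 C (Der0_val X) (Der1_val T)].
Proof. by exists (Lie2 (Der_is_lie2 C)). Qed.
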